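(* Let $K$ be an infinite field, $\sigma$ a simplicial complex on $[n]=\{1,\dots,n\}$ and $\varphi\in GL_n(K)$. Then for every $S\subset[n]$, $$m_{\preceq_{rev}S}(\Delta(\sigma))\ \ge\ m_{\preceq_{rev}S}(\Delta(\Delta_\varphi(\sigma))).$$
   Context: $E$ is the exterior algebra over $K$ of the vector space with basis $e_1,\dots,e_n$; for $S=\{s_1<\dots<s_d\}$, $e_S=e_{s_1}\wedge\cdots\wedge e_{s_d}$. The reverse lexicographic order $\prec_{rev}$ on subsets of $[n]$ (induced by $1<2<\dots<n$): for $S\ne R$, $S\prec_{rev}R$ if $|S|<|R|$, or $|S|=|R|$ and the minimal element of the symmetric difference $(S\setminus R)\cup(R\setminus S)$ lies in $S$; it is used as a term order on $E$ via $e_S\prec_{rev}e_R\iff S\prec_{rev}R$. For $f=\sum\alpha_Se_S$, $\mathrm{in}_{\prec_{rev}}(f)$ is the $\prec_{rev}$-largest $e_S$ with $\alpha_S\ne0$, and $\mathrm{in}_{\prec_{rev}}(J)$ is the ideal generated by all initial monomials of elements of $J$. For $\varphi=(a_{ij})\in GL_n(K)$, $\varphi(f(e_1,\dots,e_n))=f(\sum_ia_{i1}e_i,\dots,\sum_ia_{in}e_i)$, $\varphi(J)=\{\varphi(f):f\in J\}$. The generic initial ideal $\mathrm{Gin}_{\prec_{rev}}(J)$ is the common value of $\mathrm{in}_{\prec_{rev}}(\varphi(J))$ for $\varphi$ in a nonempty Zariski open subset of $GL_n(K)$. The exterior face ideal $J_\sigma$ of a simplicial complex $\sigma$ on $[n]$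 is the ideal of $E$ generated by all $e_S$ with $S\notin\sigma$; monomial ideals generated by such $e_S$ correspond bijectively to simplicial complexes on $[n]$. $\Delta_\varphi(\sigma)$ is the simplicial complex with $J_{\Delta_\varphi(\sigma)}=\mathrm{in}_{\prec_{rev}}(\varphi(J_\sigma))$, and the exterior algebraic shifting $\Delta(\sigma)$ is the simplicial complex with $J_{\Delta(\sigma)}=\mathrm{Gin}_{\prec_{rev}}(J_\sigma)$. For a simplicial complex $\tau$ and $S\subset[n]$, $m_{\preceq_{rev}S}(\tau)=|\{R\in\tau:\ |R|=|S|,\ R\preceq_{rev}S\}|$. *)

(* Defs.v *)
From HB Require Import structures.
From mathcomp Require Import all_boot all_order all_algebra.
From mathcomp Require Import mpoly.
From mathcomp Require Import boolp.

Set Implicit Arguments.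
Unset Strict Implicit.
Unset Printing Implicit Defensive.

Import GRing.Theory.
Local Open Scope ring_scope.

(* The exterior algebra of K^n, through coordinates on the monomial basis
   e_S: f : exterior K n stands for \sum_S f S *: e_S. The index i : 'I_n
   stands for i + 1 in [n] = {1, ..., n}. *)
Definition exterior (K : fieldType) (n : nat) : Type := {ffun {set 'I_n} -> K}.

HB.instance Definition _ (K : fieldType) (n : nat) :=
  GRing.Lmodule.copy (exterior K n) {ffun {set 'I_n} -> K^o}.

Section ExteriorAlgebra.
Variables (K : fieldType) (n : nat).
Local Notation E := (exterior K n).
Implicit Types (S T R : {set 'I_n}) (f g h : E).

Definition emon S : E := [ffun R => (R == S)%:R].

Definition coef f S : K := (f : {ffun {set 'I_n} -> K}) S.

Definition inversions S T : nat :=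
  (\sum_(s in S) \sum_(t in T) (t < s))%N.

(* e_S /\ e_T = ewedge_sign S T *: e_(S :|: T) *)
Definition ewedge_sign S T : K :=
  if [disjoint S & T] then (-1) ^+ inversions S T else 0.

Definition ewedge f g : E :=
  \sum_S \sum_T (coef f S * coef g T * ewedge_sign S T) *: emon (S :|: T).

Lemma coefD f g S : coef (f + g) S = coef f S + coef g S.
Proof. by rewrite /coef ffunE. Qed.

Lemma coefZ a f S : coef (a *: f) S = a * coef f S.
Proof. by rewrite /coef ffunE. Qed.

Lemma coef0 S : coef 0 S = 0.
Proof. by rewrite /coef ffunE. Qed.

Lemma coef_emon S R : coef (emon S) R = (R == S)%:R.
Proof. by rewrite /coef ffunE. Qed.

Lemma coef_sum (I : Type) (r : seq I) (P : pred I) (F : I -> E) S :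
  coef (\sum_(i <- r | P i) F i) S = \sum_(i <- r | P i) coef (F i) S.
Proof.
by apply: (big_morph (fun f => coef f S)) => [f g|]; rewrite ?coefD ?coef0.
Qed.

Lemma exteriorP f g : (forall S, coef f S = coef g S) -> f = g.
Proof. by move=> fg; apply/ffunP. Qed.

Lemma exteriorE f : f = \sum_S coef f S *: emon S.
Proof.
apply: exteriorP => S; rewrite coef_sum (bigD1 S) //= big1.
  by rewrite coefZ coef_emon eqxx mulr1 addr0.
by move=> T /negPf TS; rewrite coefZ coef_emon eq_sym TS mulr0.
Qed.

Lemma ewedgeDl : left_distributive ewedge +%R.
Proof.
move=> f g h; rewrite /ewedge -big_split; apply: eq_bigr => S _ /=.
rewrite -big_split; apply: eq_bigr => T _ /=.
by rewrite coefD !mulrDl scalerDl.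
Qed.

Lemma ewedgeDr : right_distributive ewedge +%R.
Proof.
move=> f g h; rewrite /ewedge -big_split; apply: eq_bigr => S _ /=.
rewrite -big_split; apply: eq_bigr => T _ /=.
by rewrite coefD mulrDr mulrDl scalerDl.
Qed.

Lemma ewedgeZl a f g : ewedge (a *: f) g = a *: ewedge f g.
Proof.
rewrite /ewedge scaler_sumr; apply: eq_bigr => S _.
rewrite scaler_sumr; apply: eq_bigr => T _.
by rewrite coefZ scalerA !mulrA.
Qed.

Lemma ewedgeZr a f g : ewedge f (a *: g) = a *: ewedge f g.
Proof.
rewrite /ewedge scaler_sumr; apply: eq_bigr => S _.
rewrite scaler_sumr; apply: eq_bigr => T _.
by rewrite coefZ scalerA !mulrA (mulrC a).
Qed.

Lemma ewedge0l f : ewedge 0 f = 0.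
Proof. by rewrite -(scale0r (0 : E)) ewedgeZl !scale0r. Qed.

Lemma ewedge0r f : ewedge f 0 = 0.
Proof. by rewrite -(scale0r (0 : E)) ewedgeZr !scale0r. Qed.

Lemma ewedge_suml (I : Type) (r : seq I) (P : pred I) (F : I -> E) g :
  ewedge (\sum_(i <- r | P i) F i) g = \sum_(i <- r | P i) ewedge (F i) g.
Proof.
by apply: (big_morph (ewedge^~ g)) => [f h|]; rewrite ?ewedgeDl ?ewedge0l.
Qed.

Lemma ewedge_sumr (I : Type) (r : seq I) (P : pred I) (F : I -> E) g :
  ewedge g (\sum_(i <- r | P i) F i) = \sum_(i <- r | P i) ewedge g (F i).
Proof.
by apply: (big_morph (ewedge g)) => [f h|]; rewrite ?ewedgeDr ?ewedge0r.
Qed.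

Lemma ewedge_emon S T :
  ewedge (emon S) (emon T) = ewedge_sign S T *: emon (S :|: T).
Proof.
rewrite /ewedge (bigD1 S) //= (bigD1 T) //= !coef_emon !eqxx !mul1r.
rewrite big1 => [|R /negPf RT]; last first.
  by rewrite coef_emon RT mulr0 mul0r scale0r.
rewrite big1 ?addr0 // => R /negPf RS.
by apply: big1 => Q _; rewrite coef_emon RS !mul0r scale0r.
Qed.

Lemma inversionsUl S T R : [disjoint S & T] ->
  inversions (S :|: T) R = (inversions S R + inversions T R)%N.
Proof.
by move=> dST; rewrite /inversions -bigU //=; apply: eq_bigl => i; rewrite inE.
Qed.

Lemma inversionsUr S T R : [disjoint T & R] ->
  inversions S (T :|: R) = (inversions S T + inversions S R)%N.
Proof.
move=> dTR; rewrite /inversions -big_split; apply: eq_bigr => i _ /=.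
by rewrite -bigU //=; apply: eq_bigl => j; rewrite inE.
Qed.

Lemma ewedge_signA S T R :
  ewedge_sign T R * ewedge_sign S (T :|: R) =
  ewedge_sign S T * ewedge_sign (S :|: T) R.
Proof.
have dUr : [disjoint S & T :|: R] = [disjoint S & T] && [disjoint S & R].
  by rewrite -!setI_eq0 setIUr setU_eq0.
have dUl : [disjoint S :|: T & R] = [disjoint S & R] && [disjoint T & R].
  by rewrite -!setI_eq0 setIUl setU_eq0.
rewrite /ewedge_sign dUr dUl.
have [dTR|] := boolP [disjoint T & R]; last by rewrite mul0r andbF mulr0.
have [dST|] := boolP [disjoint S & T]; last by rewrite mul0r /= mulr0.
have [dSR|] := boolP [disjoint S & R]; last by rewrite !mulr0.
by rewrite /= inversionsUl // inversionsUr // -!exprD addnC addnA.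
Qed.

Lemma ewedgeA : associative ewedge.
Proof.
suff wA w : w = ewedge -> associative w by exact: wA.
move=> wE f g h.
have wl (F : {set 'I_n} -> E) x : w (\sum_S F S) x = \sum_S w (F S) x.
  by rewrite wE ewedge_suml.
have wr (F : {set 'I_n} -> E) x : w x (\sum_S F S) = \sum_S w x (F S).
  by rewrite wE ewedge_sumr.
rewrite (exteriorE f) !wl; apply: eq_bigr => S _.
rewrite (exteriorE g) wr !wl wr; apply: eq_bigr => T _.
rewrite (exteriorE h) !wr; apply: eq_bigr => R _; rewrite {}wE {wl wr}.
rewrite !(ewedgeZl, ewedgeZr, ewedge_emon) setUA !scalerA; congr (_ *: _).
by rewrite -!mulrA ewedge_signA [RHS]mulrCA; congr (_ * _); rewrite mulrCA.
Qed.

Lemma ewedge1l : left_id (emon set0) ewedge.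
Proof.
move=> f; rewrite (exteriorE f) ewedge_sumr; apply: eq_bigr => S _.
rewrite ewedgeZr ewedge_emon set0U /ewedge_sign -setI_eq0 set0I eqxx.
by rewrite /inversions big_set0 expr0 scale1r.
Qed.

Lemma ewedge1r : right_id (emon set0) ewedge.
Proof.
move=> f; rewrite (exteriorE f) ewedge_suml; apply: eq_bigr => S _.
rewrite ewedgeZl ewedge_emon setU0 /ewedge_sign -setI_eq0 setI0 eqxx.
by rewrite /inversions big1 ?expr0 ?scale1r // => i _; rewrite big_set0.
Qed.

Lemma emon0_neq0 : emon set0 != 0.
Proof.
apply/eqP => /(congr1 (fun f => coef f set0)) /eqP.
by rewrite coef_emon coef0 eqxx oner_eq0.
Qed.

End ExteriorAlgebra.

HB.instance Definition _ (K : fieldType) (n : nat) :=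
  GRing.Zmodule_isNzRing.Build (exterior K n) (@ewedgeA K n) (@ewedge1l K n)
    (@ewedge1r K n) (@ewedgeDl K n) (@ewedgeDr K n) (@emon0_neq0 K n).

HB.instance Definition _ (K : fieldType) (n : nat) :=
  GRing.Lmodule_isLalgebra.Build K (exterior K n)
    (fun a f g => esym (@ewedgeZl K n a f g)).

HB.instance Definition _ (K : fieldType) (n : nat) :=
  GRing.Lalgebra_isAlgebra.Build K (exterior K n)
    (fun a f g => esym (@ewedgeZr K n a f g)).

Section Shifting.
Variables (K : fieldType) (n : nat).
Local Notation E := (exterior K n).
Local Notation e := (@emon K n).
Implicit Types (S T R : {set 'I_n}) (f g : E) (I J : E -> Prop).
Implicit Types (sigma tau : {set {set 'I_n}}) (A : 'M[K]_n).

Lemma emon1_sqr (i : 'I_n) : e [set i] * e [set i] = 0.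
Proof.
rewrite [LHS]ewedge_emon /ewedge_sign -setI_eq0 setIid.
by rewrite -cards_eq0 cards1 scale0r.
Qed.

Lemma emon1_anticomm (i j : 'I_n) :
  e [set i] * e [set j] = - (e [set j] * e [set i]).
Proof.
have [->|neq_ij] := eqVneq i j; first by rewrite emon1_sqr oppr0.
rewrite [in LHS]/GRing.mul [in RHS]/GRing.mul /= !ewedge_emon setUC -scaleNr.
congr (_ *: _); rewrite /ewedge_sign /inversions !disjoints1 !inE.
rewrite (eq_sym j) neq_ij !big_set1; case: ltngtP => [||/val_inj eq_ij].
- by rewrite /= expr0 expr1.
- by rewrite /= expr0 expr1 opprK.
by rewrite eq_ij eqxx in neq_ij.
Qed.

(* enum S lists S in increasing order; bigop does not specify the order of
   the factors of \prod_(j in S). *)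
Lemma emon_prod S : e S = \prod_(j <- enum S) e [set j].
Proof.
have lt_trans : transitive (fun i j : 'I_n => i < j)%N.
  by move=> j i k; apply: ltn_trans.
have prodE (s : seq 'I_n) : sorted (fun i j : 'I_n => i < j)%N s ->
    \prod_(j <- s) e [set j] = e [set j in s].
  elim: s => [_|j s IHs /= sorted_s].
    by rewrite big_nil [LHS]/(e set0); congr (e _); apply/setP => j; rewrite !inE.
  have lt_js := order_path_min lt_trans sorted_s.
  rewrite big_cons (IHs (path_sorted sorted_s)) {IHs}.
  rewrite [LHS]ewedge_emon /ewedge_sign disjoints1 inE.
  rewrite ifT; last by apply/negP => /(allP lt_js); rewrite ltnn.
  rewrite /inversions big_set1 big1 => [|t]; last first.
    by rewrite inE => /(allP lt_js) /= lt_jt; rewrite ltnNge ltnW.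
  by rewrite expr0 scale1r set_cons.
have sorted_S : sorted (fun i j : 'I_n => i < j)%N (enum S).
  rewrite [enum _]/enum_mem -enumT sorted_filter //.
  by have := iota_ltn_sorted 0 n; rewrite -val_enum_ord sorted_map.
rewrite prodE //; congr (e _).
by apply/setP => j; rewrite inE mem_enum.
Qed.

Definition is_ideal I : Prop :=
  [/\ I 0, forall f g, I f -> I g -> I (f + g),
      forall f g, I g -> I (f * g) & forall f g, I f -> I (f * g)].

Definition ideal_gen (X : E -> Prop) : E -> Prop :=
  fun f => forall I, is_ideal I -> (forall g, X g -> I g) -> I f.

Definition rev_lt S R : bool :=
  (#|S| < #|R|)%N || (#|S| == #|R|) &&
    [exists i in S :\: R, [forall j in (S :\: R) :|: (R :\: S), (i <= j)%N]].

Definition rev_le S R : bool := (S == R) || rev_lt S R.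

Definition is_initial f S : Prop :=
  coef f S != 0 /\ forall R, coef f R != 0 -> rev_le R S.

Definition initial_ideal J : E -> Prop :=
  ideal_gen (fun g => exists f S, [/\ J f, is_initial f S & g = e S]).

Definition gl_action A f : E :=
  \sum_S coef f S *: \prod_(j <- enum S) (\sum_i A i j *: e [set i]).

Definition gl_image A J : E -> Prop := fun g => exists2 f, J f & g = gl_action A f.

(* Polynomials in the n * n matrix entries, ordered as in mxvec. *)
Definition mx_eval (p : {mpoly K[n * n]}) A : K := p.@[fun k => mxvec A 0 k].

Definition zariski_open_GL (U : 'M[K]_n -> Prop) : Prop :=
  exists P : {mpoly K[n * n]} -> Prop,
    forall A, U A <-> A \in unitmx /\ exists2 p, P p & mx_eval p A != 0.

Definition is_gin J I : Prop :=
  exists U : 'M[K]_n -> Prop,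
    [/\ zariski_open_GL U, exists A, U A &
        forall A, U A -> forall f, initial_ideal (gl_image A J) f <-> I f].

(* The I such that is_gin J I: over an infinite field it is unique, as two
   nonempty Zariski open subsets of GL_n(K) then intersect. *)
Definition Gin J : E -> Prop := fun f => exists2 I, is_gin J I & I f.

Definition is_complex sigma : Prop :=
  forall S R, S \in sigma -> R \subset S -> R \in sigma.

Definition face_ideal sigma : E -> Prop :=
  ideal_gen (fun g => exists2 S, S \notin sigma & g = e S).

Lemma ideal_gen_ideal (X : E -> Prop) : is_ideal (ideal_gen X).
Proof.
split=> [I [] // | f g If Ig I idI XI | f g Ig I idI XI | f g If I idI XI].
- by case: (idI) => _ ID _ _; apply: ID; [apply: If|apply: Ig].
- by case: (idI) => _ _ IMl _; apply: IMl; apply: Ig.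
- by case: (idI) => _ _ _ IMr; apply: IMr; apply: If.
Qed.

(* Inverse of face_ideal on ideals generated by monomials, see
   complex_of_face_ideal and face_ideal_complex_of. *)
Definition complex_of I : {set {set 'I_n}} := [set S | `[< ~ I (e S) >]].

Lemma face_idealP sigma f : is_complex sigma ->
  face_ideal sigma f <-> forall S, S \in sigma -> coef f S = 0.
Proof.
move=> complex_sigma; split=> [|f0 I idI sI]; last first.
  case: (idI) => I0 ID IMl _; rewrite (exteriorE f).
  apply: (big_ind I) => // S _; case: (boolP (S \in sigma)) => [/f0->|nS].
    by rewrite scale0r.
  by rewrite -mulr_algl; apply: IMl; apply: sI; exists S.
pose I f := forall S, S \in sigma -> coef f S = 0.
have coefM0 g h S : (forall T R, T :|: R = S -> coef g T * coef h R = 0) ->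
    coef (g * h) S = 0.
  have -> : g * h = ewedge g h by [].
  move=> gh0; rewrite /ewedge coef_sum.
  rewrite big1 // => T _; rewrite coef_sum big1 // => R _.
  rewrite coefZ coef_emon; have [/esym eqS|_] := eqVneq S; last by rewrite mulr0.
  by rewrite gh0 ?mul0r.
move=> /(_ I); apply.
  split=> [S _|g h Ig Ih S sS|g h Ih S sS|g h Ig S sS]; first exact: coef0.
  - by rewrite coefD Ig ?Ih ?addr0.
  - apply: coefM0 => T R eqS; rewrite Ih ?mulr0 //.
    by apply: complex_sigma sS _; rewrite -eqS subsetUr.
  apply: coefM0 => T R eqS; rewrite Ig ?mul0r //.
  by apply: complex_sigma sS _; rewrite -eqS subsetUl.
move=> g [R nR ->] S sS; rewrite coef_emon.
by case: eqVneq => // eqSR; rewrite -eqSR sS in nR.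
Qed.

Lemma complex_of_face_ideal sigma :
  is_complex sigma -> complex_of (face_ideal sigma) = sigma.
Proof.
move=> complex_sigma; apply/setP => S; rewrite inE; apply/asboolP/idP.
  case: (boolP (S \in sigma)) => // nS []; apply/face_idealP => // R sR.
  by rewrite coef_emon; case: eqVneq => // eqRS; rewrite -eqRS sR in nS.
move=> sS /(face_idealP _ complex_sigma) /(_ S sS) /eqP.
by rewrite coef_emon eqxx oner_eq0.
Qed.

Lemma face_ideal_complex_of (X : {set 'I_n} -> Prop) f :
  let I := ideal_gen (fun g => exists2 S, X S & g = e S) in
  face_ideal (complex_of I) f <-> I f.
Proof.
move=> I; split=> [|If L idL sL].
  apply; first exact: ideal_gen_ideal.
  by move=> g [S]; rewrite inE => /asboolPn /contrapT IS ->.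
apply: If => // g [S XS ->]; apply: sL; exists S => //.
by rewrite inE; apply/asboolPn => -[] L' _; apply; exists S.
Qed.

Lemma is_complex_complex_of I :
  (forall f g, I g -> I (f * g)) -> is_complex (complex_of I).
Proof.
move=> IM S R; rewrite !inE => /asboolP nIS sRS; apply/asboolP => IR.
apply: nIS.
have dS : [disjoint S :\: R & R].
  by rewrite -setI_eq0 setDE -setIA (setIC _ R) setICr setI0.
pose c := (-1) ^+ inversions (S :\: R) R : K.
suff -> : e S = (c *: e (S :\: R)) * e R by apply: IM.
rewrite -scalerAl [e _ * e _]ewedge_emon /ewedge_sign dS scalerA.
rewrite -expr2 sqrr_sign scale1r; congr (e _).
by rewrite -[LHS](setID S R) (setIidPr sRS) setUC.
Qed.

Definition shift_by A sigma : {set {set 'I_n}} :=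
  complex_of (initial_ideal (gl_image A (face_ideal sigma))).

Definition shift sigma : {set {set 'I_n}} := complex_of (Gin (face_ideal sigma)).

Lemma initial_ideal_ideal J : is_ideal (initial_ideal J).
Proof. exact: ideal_gen_ideal. Qed.

Lemma is_complex_shift_by A sigma : is_complex (shift_by A sigma).
Proof.
apply: is_complex_complex_of.
by case: (initial_ideal_ideal (gl_image A (face_ideal sigma))).
Qed.

Lemma is_complex_shift sigma : is_complex (shift sigma).
Proof.
apply: is_complex_complex_of => f g [I ginI Ig]; exists I => //.
case: ginI => U [_ [A UA] /(_ A UA) inI]; apply/inI.
case: (initial_ideal_ideal (gl_image A (face_ideal sigma))) => _ _ IM _.
by apply: IM; apply/inI.
Qed.

End Shifting.

Definition m_rev (n : nat) (S : {set 'I_n}) (tau : {set {set 'I_n}}) : nat :=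
  #|[set R in tau | (#|R| == #|S|) && rev_le R S]|.

(* Main.v *)
(* Let J be the exterior face ideal of sigma and let A be in GL_n. Since the
   number of initial monomials of a subspace W lying above S is the rank of the
   projection of W onto the coordinates above S, and since A preserves degrees,
   m_{<=S}(Delta_A(sigma)) is, up to a constant depending only on S and on the
   number of faces of each size, the rank r_S(J, A) of the projection of A(J).
   This rank is lower semicontinuous in A, so it is maximal for generic A, and
   the maximum is the value for Delta(sigma). The initial ideal of phi(J) is the
   limit of D_t phi(J) for a one-parameter torus D_t whose weights induce the
   reverse lexicographic order, so semicontinuity along t gives
   r_S(in(phi(J)), A) <= r_S(J, A D_t phi) for some t <> 0. *)

From HB Require Import structures.
Require Import Defs.
From mathcomp Require Import all_boot all_order all_algebra.
From mathcomp Require Import mpoly boolp zify.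

Set Implicit Arguments.
Unset Strict Implicit.
Unset Printing Implicit Defensive.

Import GRing.Theory.
Local Open Scope ring_scope.

(** * Polynomial functions and generic rank *)

Section FunctionAlgebra.
Variables (K : fieldType) (X : Type) (C : (X -> K) -> Prop).
Hypothesis Cconst : forall a, C (fun=> a).
Hypothesis Cadd : forall F G, C F -> C G -> C (fun x => F x + G x).
Hypothesis Cmul : forall F G, C F -> C G -> C (fun x => F x * G x).

(** [C] stays abstract because two instances are used: polynomial functions of one parameter, for
    degeneration, and of the matrix entries, for genericity. *)
Lemma fun_class_sum (I : Type) (r : seq I) (P : pred I) (F : I -> X -> K) :
  (forall i, P i -> C (F i)) -> C (fun x => \sum_(i <- r | P i) F i x).
Proof.
move=> CF; elim: r => [|i r IHr].
  rewrite (_ : (fun x => _) = fun=> 0) //.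
  by apply: funext => x; rewrite big_nil.
rewrite (_ : (fun x => _) = fun x =>
    if P i then F i x + \sum_(j <- r | P j) F j x else \sum_(j <- r | P j) F j x).
  by case Pi: (P i) => //; apply: Cadd => //; apply: CF.
by apply: funext => x; rewrite big_cons.
Qed.

Lemma fun_class_prod (I : Type) (r : seq I) (P : pred I) (F : I -> X -> K) :
  (forall i, P i -> C (F i)) -> C (fun x => \prod_(i <- r | P i) F i x).
Proof.
move=> CF; elim: r => [|i r IHr].
  rewrite (_ : (fun x => _) = fun=> 1) //.
  by apply: funext => x; rewrite big_nil.
rewrite (_ : (fun x => _) = fun x =>
    if P i then F i x * \prod_(j <- r | P j) F j x else \prod_(j <- r | P j) F j x).
  by case Pi: (P i) => //; apply: Cmul => //; apply: CF.
by apply: funext => x; rewrite big_cons.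
Qed.

Lemma fun_class_det m (M : X -> 'M[K]_m) :
  (forall i j, C (fun x => M x i j)) -> C (fun x => \det (M x)).
Proof.
move=> CM; apply: fun_class_sum => s _.
by apply: Cmul => //; apply: fun_class_prod => i _.
Qed.

Lemma fun_class_mulmx m p q (M : X -> 'M[K]_(m, p)) (N : X -> 'M[K]_(p, q)) :
  (forall i j, C (fun x => M x i j)) -> (forall i j, C (fun x => N x i j)) ->
  forall i j, C (fun x => (M x *m N x) i j).
Proof.
move=> CM CN i j.
rewrite (_ : (fun x => _) = fun x => \sum_k M x i k * N x k j); last first.
  by apply: funext => x; rewrite mxE.
by apply: fun_class_sum => k _; apply: Cmul.
Qed.

Lemma rank_lower_semicontinuous m p (M : X -> 'M[K]_(m, p)) x0 :
  (forall i j, C (fun x => M x i j)) ->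
  exists F, [/\ C F, F x0 != 0 &
                forall x, F x != 0 -> (\rank (M x0) <= \rank (M x))%N].
Proof.
move=> CM.
(* [det (L M N)] is a minor of [M] in the right bases: it is 1 at [x0], and
   bounds the rank of [M x] from below by [\rank (M x0)] when nonzero. *)
have /row_fullP[L LE] : row_full (col_base (M x0)) by exact: col_base_full.
have /row_freeP[N NE] : row_free (row_base (M x0)) by exact: row_base_free.
exists (fun x => \det (L *m M x *m N)); split=> [||x Fx].
- by apply: fun_class_det; apply: fun_class_mulmx => //; apply: fun_class_mulmx.
- rewrite (_ : L *m M x0 *m N = 1%:M) ?det1 ?oner_neq0 //.
  by rewrite -[X in L *m X](mulmx_base (M x0)) mulmxA LE mul1mx NE.
have /mxrank_unit <- : L *m M x *m N \in unitmx by rewrite unitmxE unitfE.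
exact: leq_trans (mxrankM_maxl _ _) (mxrankM_maxr _ _).
Qed.

End FunctionAlgebra.

(** * Nonvanishing of polynomial functions over an infinite field *)

Section PolynomialFunctions.
Variables (K : fieldType).
Hypothesis Kinf : forall s : seq K, exists x : K, x \notin s.

Definition poly_fun (F : K -> K) := exists q : {poly K}, forall t, F t = q.[t].

Lemma poly_fun_const a : poly_fun (fun=> a).
Proof. by exists a%:P => t; rewrite hornerC. Qed.

Lemma poly_funD F G : poly_fun F -> poly_fun G -> poly_fun (fun t => F t + G t).
Proof. by move=> [p Fp] [q Gq]; exists (p + q) => t; rewrite hornerD Fp Gq. Qed.

Lemma poly_funM F G : poly_fun F -> poly_fun G -> poly_fun (fun t => F t * G t).
Proof. by move=> [p Fp] [q Gq]; exists (p * q) => t; rewrite hornerM Fp Gq. Qed.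

(** The points [a] and [b] only witness that both polynomials are nonzero. Their product then has
    fewer than [size (p * q)] roots, and an infinite field contains that many distinct elements. *)
Lemma poly_fun_meet F G a b : poly_fun F -> poly_fun G ->
  F a != 0 -> G b != 0 -> exists t, F t != 0 /\ G t != 0.
Proof.
move=> [p Fp] [q Gq]; rewrite Fp Gq => pa qb.
have p0 : p != 0 by apply: contraNneq pa => ->; rewrite horner0.
have q0 : q != 0 by apply: contraNneq qb => ->; rewrite horner0.
have [s [s_uniq s_size]] : exists s : seq K, uniq s /\ size s = size (p * q).
  elim: (size _) => [|k [s [s_uniq s_size]]]; first by exists [::].
  by have [x xs] := Kinf s; exists (x :: s); rewrite /= xs s_size.
have : ~~ all (root (p * q)) s.
  apply/negP => /max_poly_roots; rewrite mulf_neq0 // => /(_ isT s_uniq).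
  by rewrite s_size ltnn.
case/allPn => t _; rewrite rootM negb_or => /andP[pt qt].
by exists t; rewrite Fp Gq.
Qed.

Variable n : nat.
Implicit Types (A B : 'M[K]_n) (F G : 'M[K]_n -> K).

Definition mx_poly_fun F := exists p, forall A, F A = mx_eval p A.

Lemma mx_poly_fun_const a : mx_poly_fun (fun=> a).
Proof. by exists a%:MP => A; rewrite /mx_eval mevalC. Qed.

Lemma mx_poly_funD F G :
  mx_poly_fun F -> mx_poly_fun G -> mx_poly_fun (fun A => F A + G A).
Proof.
by move=> [p Fp] [q Gq]; exists (p + q) => A; rewrite /mx_eval mevalD Fp Gq.
Qed.

Lemma mx_poly_funM F G :
  mx_poly_fun F -> mx_poly_fun G -> mx_poly_fun (fun A => F A * G A).
Proof.
by move=> [p Fp] [q Gq]; exists (p * q) => A; rewrite /mx_eval mevalM Fp Gq.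
Qed.

Lemma mx_poly_fun_entry i j : mx_poly_fun (fun A => A i j).
Proof. by exists 'X_(mxvec_index i j) => A; rewrite /mx_eval mevalXU mxvecE. Qed.

Lemma mx_poly_fun_det : mx_poly_fun (fun A => \det A).
Proof.
apply: (fun_class_det mx_poly_fun_const mx_poly_funD mx_poly_funM).
exact: mx_poly_fun_entry.
Qed.

Lemma mx_poly_fun_line F A B :
  mx_poly_fun F -> poly_fun (fun t => F (A + t *: (B - A))).
Proof.
case=> p Fp; rewrite (_ : (fun t => _) = fun t => \sum_(m <- msupp p)
    p@_m * \prod_k mxvec (A + t *: (B - A)) 0 k ^+ m k); last first.
  by apply: funext => t; rewrite Fp /mx_eval mevalE.
have pfS := fun_class_sum poly_fun_const poly_funD.
have pfP := fun_class_prod poly_fun_const poly_funM.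
apply: pfS => m _; apply: poly_funM; first exact: poly_fun_const.
apply: pfP => k _; exists (((mxvec A 0 k)%:P + 'X * (mxvec (B - A) 0 k)%:P) ^+ m k).
by move=> t; rewrite horner_exp hornerD hornerM !hornerC hornerX linearD linearZ !mxE.
Qed.

(** Restriction to the line through [A] (at 0) and [B] (at 1) reduces this to one variable. The line
    may leave GL_n, so invertibility is imposed later through the polynomial function [\det]. *)
Lemma mx_poly_fun_meet F G A B : mx_poly_fun F -> mx_poly_fun G ->
  F A != 0 -> G B != 0 -> exists D, F D != 0 /\ G D != 0.
Proof.
move=> pF pG FA GB.
have [||t [Ft Gt]] :=
    poly_fun_meet (a := 0) (b := 1) (mx_poly_fun_line A B pF) (mx_poly_fun_line A B pG).
- by rewrite scale0r addr0.
- by rewrite scale1r addrC subrK.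
by exists (A + t *: (B - A)).
Qed.

Lemma mx_poly_fun_meet_seq (I : Type) (r : seq I) (F : I -> 'M[K]_n -> K) :
  (forall i, mx_poly_fun (F i)) -> (forall i, exists A, F i A != 0) ->
  exists A, \prod_(i <- r) F i A != 0.
Proof.
move=> pF Fn0; elim: r => [|i r [A FA]].
  by exists 0; rewrite big_nil oner_neq0.
have [B FB] := Fn0 i.
have pprod : mx_poly_fun (fun A => \prod_(i <- r) F i A).
  exact: (fun_class_prod mx_poly_fun_const mx_poly_funM).
have [D [FiD FrD]] := mx_poly_fun_meet (pF i) pprod FB FA.
by exists D; rewrite big_cons mulf_neq0.
Qed.

End PolynomialFunctions.

(** * Initial sets of a row space *)

Section InitialSets.
Variables (K : fieldType) (T : finType) (wt : T -> nat).
Hypothesis wt_inj : injective wt.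
Local Notation N := #|T|.

(** All [N] columns are kept, those outside [U] being zeroed, so that projections compose without
    reindexing. *)
Definition coord_proj (U : {set T}) : 'M[K]_N :=
  diag_mx (\row_i (enum_val i \in U)%:R).

Lemma mul_coord_projE m (A : 'M[K]_(m, N)) (U : {set T}) i j :
  (A *m coord_proj U) i j = if enum_val j \in U then A i j else 0.
Proof. by rewrite mul_mx_diag !mxE; case: ifP; rewrite (mulr1, mulr0). Qed.

Lemma coord_projM (U V : {set T}) :
  coord_proj U *m coord_proj V = coord_proj (U :&: V).
Proof.
apply/matrixP => i j; rewrite mul_coord_projE !mxE inE.
case: eqVneq => [->|_]; last by case: ifP.
by case: (_ \in U); case: (_ \in V).
Qed.

Definition is_init m (W : 'M[K]_(m, N)) (R : T) : Prop :=
  exists v : 'rV[K]_N, [/\ (v <= W)%MS, v 0 (enum_rank R) != 0 &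
    forall Q, v 0 (enum_rank Q) != 0 -> (wt Q <= wt R)%N].

Definition init_set m (W : 'M[K]_(m, N)) : {set T} := [set R | `[< is_init W R >]].

(** This is an echelon form argument. As [U] is upward closed, vectors with initial coordinate
    outside [U] are killed, while vectors with distinct initial coordinates in [U] keep independent
    images. *)
Lemma rank_coord_proj m (W : 'M[K]_(m, N)) (U : {set T}) :
  (forall R Q, R \in U -> (wt R <= wt Q)%N -> Q \in U) ->
  \rank (W *m coord_proj U) = #|init_set W :&: U|.
Proof.
elim: {U}#|U| {-2}U (erefl #|U|) => [|k IHk] U Uk upU.
  have U0 := cards0_eq Uk; rewrite U0 setI0 cards0; apply/eqP; rewrite mxrank_eq0.
  by apply/eqP/matrixP => i j; rewrite mul_coord_projE inE mxE.
have [R0 R0U] : exists R, R \in U by apply/card_gt0P; rewrite Uk.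
pose x := [arg min_(R < R0 in U) wt R].
have [xU xmin] : x \in U /\ forall R, R \in U -> (wt x <= wt R)%N.
  by rewrite /x; case: arg_minnP.
have IH := IHk (U :\ x); rewrite (cardsD1 x U) xU in Uk.
have {}IH := IH (succn_inj Uk).
have upU' R Q : R \in U :\ x -> (wt R <= wt Q)%N -> Q \in U :\ x.
  rewrite !inE => /andP[Rx RU] RQ; rewrite (upU R) // andbT.
  apply: contra_neq Rx => Qx; apply: wt_inj; apply/eqP.
  by rewrite eqn_leq xmin // andbT -Qx.
have {}IH := IH upU'.
have WU' : W *m coord_proj (U :\ x) = W *m coord_proj U *m coord_proj (U :\ x).
  by rewrite -mulmxA coord_projM (setIidPr (subD1set _ _)).
(* Dropping the lowest coordinate x of U loses a kernel contained in the line
   of x, which is the whole line exactly when x is initial. *)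
rewrite -(mxrank_mul_ker _ (coord_proj (U :\ x))) -WU' IH.
rewrite (cardsD1 x (init_set W :&: U)) setIDA addnC inE xU andbT; congr (_ + _)%N.
set L := (_ :&: _)%MS; pose dx : 'rV[K]_N := delta_mx 0 (enum_rank x).
have kerE (v : 'rV_N) : (v <= kermx (coord_proj (U :\ x)))%MS =
    (v *m coord_proj (U :\ x) == 0) by exact/sub_kermxP/eqP.
(* A coordinate heavier than [x] lies in [U :\ x], where [w] vanishes; hence [x] is initial for [w]
   as soon as [w] is nonzero at [x]. *)
have supp (w : 'rV_N) : w *m coord_proj U *m coord_proj (U :\ x) = 0 ->
    w *m coord_proj U = w 0 (enum_rank x) *: dx /\
    forall Q, w 0 (enum_rank Q) != 0 -> (wt Q <= wt x)%N.
  rewrite -mulmxA coord_projM (setIidPr (subD1set _ _)) => w0.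
  have w0Q Q : Q \in U :\ x -> w 0 (enum_rank Q) = 0.
    move=> QU; have /matrixP/(_ 0 (enum_rank Q)) := w0.
    by rewrite mul_coord_projE enum_rankK QU mxE.
  split=> [|Q wQ].
    apply/rowP => j; rewrite mul_coord_projE [RHS]mxE [dx _ _]mxE eqxx /=.
    have [->|jx] := eqVneq j (enum_rank x); first by rewrite enum_rankK xU /= mulr1.
    rewrite /= mulr0; case: ifP => // jU; rewrite -(enum_valK j) w0Q //.
    by rewrite !inE jU andbT; apply: contra_neq jx => <-; rewrite enum_valK.
  rewrite leqNgt; apply: contra wQ => xQ; apply/eqP; apply: w0Q.
  rewrite !inE (upU x) ?(ltnW xQ) // andbT.
  by apply: contraTneq xQ => ->; rewrite ltnn.
have Ldx : (L <= dx)%MS.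
  apply/row_subP => i; have := row_sub i L; rewrite sub_capmx => /andP[].
  case/submxP=> u ->; rewrite kerE mulmxA => /eqP /supp[-> _].
  exact: scalemx_sub.
have [/asboolP[w [/submxP[u ->] wx wQ]]|Nx] := boolP `[< is_init W x >].
  (* Every element of [U :\ x] is heavier than [x], so a vector with initial coordinate [x] vanishes
     there. *)
  have w0 : u *m W *m coord_proj U *m coord_proj (U :\ x) = 0.
    rewrite -mulmxA coord_projM (setIidPr (subD1set _ _)).
    apply/rowP => j; rewrite mul_coord_projE [RHS]mxE.
    have := enum_valK j; set Q := enum_val j => <-; case: ifP => // QU.
    apply/eqP; apply: contraT => /wQ Qx; move: QU; rewrite !inE => /andP[Qnx QU].
    case/negP: Qnx; apply/eqP; apply: wt_inj; apply/eqP.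
    by rewrite eqn_leq Qx xmin.
  have [wU _] := supp _ w0.
  have dxL : (dx <= L)%MS.
    rewrite -(eqmx_scale _ wx) -wU sub_capmx kerE w0 eqxx andbT.
    by rewrite -mulmxA submxMl.
  have -> : x \in init_set W.
    by rewrite inE; apply/asboolP; exists (u *m W); rewrite submxMl.
  rewrite /= -[RHS](mxrank_delta K (0 : 'I_1) (enum_rank x)).
  by apply/eqP; rewrite eqn_leq !mxrankS.
rewrite inE (negPf Nx); apply/eqP; rewrite mxrank_eq0 -submx0.
apply/row_subP => i; have := row_sub i L; rewrite sub_capmx => /andP[].
case/submxP=> u ->; rewrite kerE mulmxA => /eqP /supp[-> uQ].
have [->|ux] := eqVneq ((u *m W) 0 (enum_rank x)) 0; first by rewrite scale0r sub0mx.
by case/asboolP: Nx; exists (u *m W); rewrite submxMl.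
Qed.

End InitialSets.

(** * Weights for the reverse lexicographic order *)

Section RevWeight.
Variable n : nat.
Implicit Types S R : {set 'I_n}.

(* The term 2 ^ n per element makes the size of a set decisive; the binary
   expansion subtracted from it, which is below 2 ^ n in total, orders sets of
   equal size by their first difference. *)
Definition rev_weight1 (i : 'I_n) : nat := (2 ^ n - 2 ^ (n - i.+1))%N.

Definition rev_weight S : nat := \sum_(i in S) rev_weight1 i.

Definition bin_weight S : nat := \sum_(i in S) 2 ^ (n - i.+1).

Lemma rev_bin_weight S : (rev_weight S + bin_weight S = #|S| * 2 ^ n)%N.
Proof.
rewrite /rev_weight /bin_weight -big_split /= -sum_nat_const.
by apply: eq_bigr => i _; rewrite subnK // leq_exp2l // leq_subr.
Qed.

(** The powers attached to the indices from [k] on form a geometric sum equal to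
    [2 ^ (n - k) - 1]. *)
Lemma bin_weight_lt S k : (k <= n)%N -> (forall i, i \in S -> (k <= i)%N) ->
  (bin_weight S < 2 ^ (n - k))%N.
Proof.
move=> kn Sk.
have -> : (2 ^ (n - k) = (\sum_(k <= i < n) 2 ^ (n - i.+1)).+1)%N.
  move dE: (n - k)%N => d; elim: d k kn dE {Sk} => [|d IHd] k kn dE.
    by rewrite big_geq //; lia.
  rewrite big_ltn; last by lia.
  rewrite -addnS -(IHd k.+1); try lia.
  by rewrite (_ : n - k.+1 = d)%N; [rewrite expnS mul2n addnn | lia].
rewrite ltnS (big_nat_widenl _ 0) // big_mkord.
rewrite [leqRHS](bigID (mem S)) /= (leq_trans _ (leq_addr _ _)) //.
rewrite /bin_weight big_mkcond [leqRHS]big_mkcond leq_sum // => i _.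
by case: ifP => // iS; rewrite Sk.
Qed.

(** For equal sizes, the first difference [m] lies in [S] and contributes [2 ^ (n - m.+1)], more
    than all of [R :\: S], whose elements exceed [m]. So [S] has the larger [bin_weight], hence the
    smaller [rev_weight]. *)
Lemma rev_lt_weight S R : rev_lt S R -> (rev_weight S < rev_weight R)%N.
Proof.
have [wS wR] := (rev_bin_weight S, rev_bin_weight R).
have bR : (bin_weight R < 2 ^ n)%N.
  by have := @bin_weight_lt R 0 (leq0n _) (fun _ _ => leq0n _); rewrite subn0.
case/orP=> [SR|/andP[/eqP SR /exists_inP[m]]].
  have : (#|S|.+1 * 2 ^ n <= #|R| * 2 ^ n)%N by rewrite leq_mul2r SR orbT.
  by rewrite mulSn; lia.
rewrite inE => /andP[mR mS] /forall_inP minm.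
have split2 A B : bin_weight A = (bin_weight (A :&: B) + bin_weight (A :\: B))%N.
  by rewrite /bin_weight (big_setID B).
have: (bin_weight (R :\: S) < 2 ^ (n - m.+1))%N.
  apply: bin_weight_lt => // i; rewrite inE => /andP[iS iR].
  have mi : (m <= i)%N by apply: minm; rewrite !inE iS iR orbT.
  by rewrite ltn_neqAle mi andbT; apply: contraTneq iR => /val_inj <-.
have: (2 ^ (n - m.+1) <= bin_weight (S :\: R))%N.
  by rewrite /bin_weight (bigD1 m) ?inE ?mR //= leq_addr.
by have [] := (split2 S R, split2 R S); rewrite (setIC R S) -SR in wR *; lia.
Qed.

Lemma rev_lt_total S R : S != R -> rev_lt S R || rev_lt R S.
Proof.
move=> SR; rewrite /rev_lt; case: ltngtP => //= SRc.
pose D := (S :\: R) :|: (R :\: S).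
have [m0 m0D] : exists m, m \in D.
  apply/set0Pn; apply: contraNneq SR => /eqP.
  by rewrite setU_eq0 !setD_eq0 -eqEsubset.
have [m mD minm] : exists2 m, m \in D & forall i, i \in D -> (m <= i)%N.
  by case: (arg_minnP (fun i : 'I_n => i : nat) m0D) => m; exists m.
have all_m : [forall j in D, (m <= j)%N] by apply/forall_inP.
move: (mD); rewrite inE => /orP[mS|mR]; apply/orP; [left|right].
  by apply/exists_inP; exists m.
by rewrite /D setUC in all_m; apply/exists_inP; exists m.
Qed.

Lemma rev_weight_inj : injective rev_weight.
Proof.
move=> S R wSR; apply/eqP; apply: contraT => /rev_lt_total.
by case/orP=> /rev_lt_weight; rewrite wSR ltnn.
Qed.

Lemma rev_leE S R : rev_le S R = (rev_weight S <= rev_weight R)%N.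
Proof.
rewrite /rev_le; have [->|SR] /= := eqVneq S R; first by rewrite leqnn.
apply/idP/idP=> [/rev_lt_weight/ltnW //|].
by have /orP[//|/rev_lt_weight] := rev_lt_total SR; rewrite ltnNge => /negPf->.
Qed.

(** Additivity makes the order compatible with wedge products and lets a diagonal matrix scale each
    monomial by a power given by its weight. *)
Lemma rev_weightU S R : [disjoint S & R] ->
  rev_weight (S :|: R) = (rev_weight S + rev_weight R)%N.
Proof.
by move=> dSR; rewrite /rev_weight -bigU //=; apply: eq_bigl => i; rewrite inE.
Qed.

Lemma rev_weight_card S R : (rev_weight S <= rev_weight R)%N -> (#|S| <= #|R|)%N.
Proof.
by rewrite -rev_leE => /orP[/eqP->|/orP[/ltnW|/andP[/eqP->]]].
Qed.

End RevWeight.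

(** * The action of GL_n on the exterior algebra *)

Section ExteriorMorphism.
Variables (K : fieldType) (n : nat).
Local Notation E := (exterior K n).
Local Notation e := (@emon K n).
Implicit Types (S R T : {set 'I_n}) (f g : E).

Lemma emonM S R : e S * e R = ewedge_sign K S R *: e (S :|: R).
Proof. exact: ewedge_emon. Qed.

Lemma emon0 : e set0 = 1.
Proof. by []. Qed.

Lemma emonM_lt (i : 'I_n) S : (forall j, j \in S -> (i < j)%N) ->
  e [set i] * e S = e (i |: S).
Proof.
move=> lt_iS; rewrite emonM /ewedge_sign disjoints1 ifT.
  rewrite /inversions big_set1 big1 ?expr0 ?scale1r // => t /lt_iS.
  by case: ltngtP.
by apply/negP => /lt_iS; rewrite ltnn.
Qed.

Lemma enum_setU1_lt (i : 'I_n) S : (forall j, j \in S -> (i < j)%N) ->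
  enum (i |: S) = i :: enum S.
Proof.
move=> lt_iS.
have lt_tr : transitive (fun j k : 'I_n => (j < k)%N).
  by move=> j k l; apply: ltn_trans.
have sorted_enum R : sorted (fun j k : 'I_n => (j < k)%N) (enum R).
  rewrite [enum _]/enum_mem -enumT sorted_filter //.
  by have := iota_ltn_sorted 0 n; rewrite -val_enum_ord sorted_map.
apply: (irr_sorted_eq lt_tr) => [j|||j]; first exact: ltnn.
- exact: sorted_enum.
- rewrite /= path_min_sorted ?sorted_enum //.
  by apply/allP => j; rewrite mem_enum => /lt_iS.
by rewrite mem_enum !inE mem_enum.
Qed.

(** Any [T] other than [R :\: S] with [S :|: T = R] meets [S], so its sign is zero. *)
Lemma coef_emonM S f R :
  coef (e S * f) R =
  if S \subset R then ewedge_sign K S (R :\: S) * coef f (R :\: S) else 0.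
Proof.
rewrite [in LHS](exteriorE f) mulr_sumr Defs.coef_sum.
under eq_bigr => T _ do rewrite -scalerAr emonM scalerA Defs.coefZ coef_emon.
case: ifP => [SR|/negP SR].
  have SRK : S :|: R :\: S = R by rewrite -[RHS](setID R S) (setIidPr SR).
  rewrite (bigD1 (R :\: S)) //= SRK.
  rewrite eqxx mulr1 mulrC big1 ?addr0 // => T TR.
  have [RE|] := eqVneq R (S :|: T); last by rewrite mulr0.
  rewrite /ewedge_sign; case: ifP => [dST|]; last by rewrite mulr0 mul0r.
  case/eqP: TR; rewrite RE setDUl setDv set0U; apply/esym/setDidPl.
  by rewrite disjoint_sym.
rewrite big1 // => T _; have [RE|] := eqVneq R (S :|: T); last by rewrite mulr0.
by case: SR; rewrite RE subsetUl.
Qed.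

Lemma coefM_card f g R : coef (f * g) R != 0 ->
  exists S T, [/\ coef f S != 0, coef g T != 0 & #|R| = (#|S| + #|T|)%N].
Proof.
rewrite [f * g]/(ewedge f g) /ewedge Defs.coef_sum => fg.
have [S] : exists S,
    coef (\sum_T (coef f S * coef g T * ewedge_sign K S T) *: e (S :|: T)) R != 0.
  apply: contrapT => H; case/eqP: fg; apply: big1 => S _.
  by apply/eqP; apply: contra_notT H => SR; exists S.
rewrite Defs.coef_sum => fgS.
have [T] : exists T,
    coef ((coef f S * coef g T * ewedge_sign K S T) *: e (S :|: T)) R != 0.
  apply: contrapT => H; case/eqP: fgS; apply: big1 => T _.
  by apply/eqP; apply: contra_notT H => SR; exists T.
rewrite Defs.coefZ coef_emon !mulf_eq0 !negb_or /ewedge_sign -!andbA.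
case: ifP => [dST|]; last by rewrite eqxx !andbF.
case/and4P=> fS gT _; have [-> _|_] := eqVneq R (S :|: T); last by rewrite eqxx.
by exists S, T; rewrite cardsU disjoint_setI0 // cards0 subn0.
Qed.

Variable v : 'I_n -> E.
Hypothesis v_sqr : forall i, v i * v i = 0.
Hypothesis v_anticomm : forall i j, v i * v j = - (v j * v i).

(** The morphism given by the universal property of the exterior algebra; for [v := gl_gen A] it is
    [gl_action A]. *)
Definition ext_map f : E := \sum_S coef f S *: \prod_(j <- enum S) v j.

Lemma ext_map_is_linear : linear ext_map.
Proof.
move=> a f g; rewrite /ext_map scaler_sumr -big_split; apply: eq_bigr => S _ /=.
by rewrite Defs.coefD Defs.coefZ scalerDl scalerA.
Qed.

HB.instance Definition _ :=
  GRing.isLinear.Build K E E _ ext_map ext_map_is_linear.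

Lemma ext_map_emon S : ext_map (e S) = \prod_(j <- enum S) v j.
Proof.
rewrite /ext_map (bigD1 S) //= coef_emon eqxx scale1r.
rewrite [X in _ + X]big1 ?addr0 // => T TS.
by rewrite coef_emon (negPf TS) scale0r.
Qed.

Lemma ext_map1 : ext_map 1 = 1.
Proof. by rewrite -emon0 ext_map_emon enum_set0 big_nil. Qed.

Lemma ext_mapM_lt (i : 'I_n) S : (forall j, j \in S -> (i < j)%N) ->
  ext_map (e [set i] * e S) = v i * ext_map (e S).
Proof.
by move=> iS; rewrite emonM_lt // !ext_map_emon enum_setU1_lt // big_cons.
Qed.

(** Insertion of [i] into the sorted product, with [j] the least element of [S]: if [i < j] the
    product is sorted, if [i = j] both sides vanish, and if [i > j] anticommuting past [j] leaves
    the smaller set [S :\ j]. *)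
Lemma ext_mapM1_emon i S : ext_map (e [set i] * e S) = v i * ext_map (e S).
Proof.
have [k] := ubnP #|S|; elim: k i S => // k IHk i S; rewrite ltnS => Sk.
have [->|[j0 j0S]] := set_0Vmem S.
  by apply: ext_mapM_lt => j; rewrite inE.
have [j jS minj] : exists2 j, j \in S & forall i, i \in S -> (j <= i)%N.
  by case: (arg_minnP (fun i : 'I_n => i : nat) j0S) => j; exists j.
have [ij|ji] := ltnP i j.
  by apply: ext_mapM_lt => l /minj; apply: leq_trans.
have lt_j l : l \in S :\ j -> (j < l)%N.
  rewrite !inE => /andP[lj lS]; rewrite ltn_neqAle minj // andbT.
  by apply: contra_neq lj => /val_inj.
have SE : e S = e [set j] * e (S :\ j) by rewrite emonM_lt // setD1K.
rewrite SE (ext_mapM_lt lt_j).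
have [->|ij] := eqVneq i j.
  by rewrite !mulrA emon1_sqr v_sqr !mul0r linear0.
rewrite !mulrA emon1_anticomm v_anticomm !mulNr linearN -!mulrA; congr (- _).
(* The product of the [i]-th generator with [e (S :\ j)] becomes a signed monomial, the sign being 0
   if [i] is in [S :\ j]. All its indices exceed [j], so the sorted case applies. *)
rewrite emonM -scalerAr !linearZ /= ext_mapM_lt => [|l].
  rewrite scalerAr -linearZ /= -emonM IHk //.
  by rewrite (leq_trans _ Sk) // [X in (_ < X)%N](cardsD1 j) jS.
rewrite !inE => /predU1P[->|/andP[lj lS]].
  by rewrite ltn_neqAle ji andbT; apply: contra_neq ij => /val_inj ->.
by apply: lt_j; rewrite !inE lj.
Qed.

Lemma ext_mapM1 i f : ext_map (e [set i] * f) = v i * ext_map f.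
Proof.
rewrite [in LHS](exteriorE f) mulr_sumr linear_sum /=.
rewrite [ext_map f]/ext_map mulr_sumr; apply: eq_bigr => S _.
by rewrite -!scalerAr linearZ /= ext_mapM1_emon ext_map_emon.
Qed.

Lemma ext_mapM : {morph ext_map : f g / f * g}.
Proof.
move=> f g; rewrite [in LHS](exteriorE f) mulr_suml linear_sum /=.
rewrite [ext_map f]/ext_map mulr_suml; apply: eq_bigr => S _.
rewrite -!scalerAl linearZ /= emon_prod; congr (_ *: _).
elim: (enum S) => [|i s IHs]; first by rewrite !big_nil !mul1r.
by rewrite !big_cons -!mulrA ext_mapM1 IHs.
Qed.

Lemma ext_map_prod (s : seq 'I_n) (F : 'I_n -> E) :
  ext_map (\prod_(j <- s) F j) = \prod_(j <- s) ext_map (F j).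
Proof. exact: (big_morph _ ext_mapM ext_map1). Qed.

End ExteriorMorphism.

(** * Multiplicativity of the action and its matrix on the monomial basis *)

Section GLAction.
Variables (K : fieldType) (n : nat).
Local Notation E := (exterior K n).
Local Notation e := (@emon K n).
Implicit Types (S R T : {set 'I_n}) (f g : E) (A B : 'M[K]_n).

Definition gl_gen A (j : 'I_n) : E := \sum_i A i j *: e [set i].

Lemma lincomb_anticomm (a b : 'I_n -> K) (r s : seq 'I_n) :
  (\sum_(i <- r) a i *: e [set i]) * (\sum_(i <- s) b i *: e [set i]) =
  - ((\sum_(i <- s) b i *: e [set i]) * (\sum_(i <- r) a i *: e [set i])).
Proof.
rewrite !mulr_suml -sumrN; under eq_bigr => i _ do rewrite mulr_sumr.
under [RHS]eq_bigr => i _ do rewrite mulr_sumr -sumrN.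
rewrite exchange_big; apply: eq_bigr => i _; apply: eq_bigr => j _.
rewrite -!scalerAl -!scalerAr !scalerA emon1_anticomm scalerN.
by rewrite (mulrC (a j)).
Qed.

(** In characteristic 2 anticommutation does not force squares to vanish, hence a separate induction
    on the list of generators. *)
Lemma lincomb_sqr (a : 'I_n -> K) (r : seq 'I_n) :
  (\sum_(i <- r) a i *: e [set i]) * (\sum_(i <- r) a i *: e [set i]) = 0.
Proof.
elim: r => [|i r IHr]; first by rewrite big_nil mul0r.
rewrite big_cons mulrDl !mulrDr IHr addr0 -scalerAl -scalerAr emon1_sqr !scaler0 add0r.
have := lincomb_anticomm a a [:: i] r; rewrite big_seq1 => ->.
by rewrite addNr.
Qed.

Lemma gl_gen_anticomm A i j : gl_gen A i * gl_gen A j = - (gl_gen A j * gl_gen A i).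
Proof. exact: lincomb_anticomm. Qed.

Lemma gl_gen_sqr A i : gl_gen A i * gl_gen A i = 0.
Proof. exact: lincomb_sqr. Qed.

Lemma gl_action_is_linear A : linear (gl_action A).
Proof. exact: ext_map_is_linear. Qed.

HB.instance Definition _ A :=
  GRing.isLinear.Build K E E _ (gl_action A) (gl_action_is_linear A).

Lemma gl_action_emon A S : gl_action A (e S) = \prod_(j <- enum S) gl_gen A j.
Proof. exact: ext_map_emon. Qed.

Lemma gl_actionM A : {morph gl_action A : f g / f * g}.
Proof. exact: ext_mapM (gl_gen_sqr A) (gl_gen_anticomm A). Qed.

Lemma gl_action_prod A (s : seq 'I_n) (F : 'I_n -> E) :
  gl_action A (\prod_(j <- s) F j) = \prod_(j <- s) gl_action A (F j).
Proof. exact: ext_map_prod (gl_gen_sqr A) (gl_gen_anticomm A) s F. Qed.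

Lemma gl_action_emon1 A i : gl_action A (e [set i]) = gl_gen A i.
Proof. by rewrite gl_action_emon enum_set1 big_seq1. Qed.

Lemma gl_action_comp A B f : gl_action A (gl_action B f) = gl_action (A *m B) f.
Proof.
rewrite [gl_action B f]/gl_action linear_sum /=; apply: eq_bigr => S _.
rewrite linearZ /=; congr (_ *: _).
rewrite gl_action_prod; apply: eq_bigr => j _; rewrite linear_sum /=.
under eq_bigr => k _ do rewrite linearZ /= gl_action_emon1 /gl_gen scaler_sumr.
rewrite exchange_big; apply: eq_bigr => i _ /=.
under eq_bigr => k _ do rewrite scalerA mulrC.
by rewrite -scaler_suml mxE.
Qed.

Lemma gl_action_diag (d : 'rV[K]_n) S :
  gl_action (diag_mx d) (e S) = (\prod_(i in S) d 0 i) *: e S.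
Proof.
have genE j : gl_gen (diag_mx d) j = d 0 j *: e [set j].
  rewrite /gl_gen (bigD1 j) //= mxE eqxx mulr1n big1 ?addr0 // => i ij.
  by rewrite mxE (negPf ij) mulr0n scale0r.
rewrite gl_action_emon -big_enum emon_prod.
elim: (enum S) => [|j s IHs]; first by rewrite !big_nil scale1r.
by rewrite !big_cons genE IHs -scalerAl -scalerAr scalerA.
Qed.

Lemma gl_action1 f : gl_action 1%:M f = f.
Proof.
rewrite [in RHS](exteriorE f) [in LHS](exteriorE f) linear_sum /=.
apply: eq_bigr => S _; rewrite linearZ /=; congr (_ *: _).
rewrite -diag_const_mx gl_action_diag big1 ?scale1r // => i _.
by rewrite mxE.
Qed.

Lemma gl_action_card A S R : coef (gl_action A (e S)) R != 0 -> (#|R| <= #|S|)%N.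
Proof.
rewrite gl_action_emon (cardE S); elim: (enum S) R => [|j s IHs] R.
  rewrite big_nil coef_emon; have [-> _|_] := eqVneq R set0.
    by rewrite cards0.
  by rewrite eqxx.
rewrite big_cons => /coefM_card[T [Q [gT /IHs Qs ->]]]; rewrite /= -add1n leq_add //.
suff: #|T| = 1%N by move->.
apply: contraNeq gT => T1; rewrite /gl_gen Defs.coef_sum big1 // => i _.
rewrite Defs.coefZ coef_emon; have [Ti|_] := eqVneq T [set i].
  by rewrite Ti cards1 eqxx in T1.
by rewrite mulr0.
Qed.

Lemma gl_action_mx_poly_fun S R :
  mx_poly_fun (fun A => coef (gl_action A (e S)) R).
Proof.
have cst := @mx_poly_fun_const K n.
have pfS := fun_class_sum cst (@mx_poly_funD K n).
have pfM := @mx_poly_funM K n.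
rewrite (_ : (fun A => _) =
    fun A => coef (\prod_(j <- enum S) gl_gen A j) R); last first.
  by apply: funext => A; rewrite gl_action_emon.
elim: (enum S) R => [|j s IHs] R.
  by under [X in mx_poly_fun X]funext => A do rewrite big_nil.
rewrite (_ : (fun A => _) = fun A => \sum_T \sum_Q
    (\sum_i A i j * coef (e [set i]) T) * coef (\prod_(k <- s) gl_gen A k) Q *
    ewedge_sign K T Q * coef (e (T :|: Q)) R); last first.
  apply: funext => A; rewrite big_cons [gl_gen A j * _]/(ewedge _ _) Defs.coef_sum.
  apply: eq_bigr => T _; rewrite Defs.coef_sum; apply: eq_bigr => Q _.
  rewrite Defs.coefZ Defs.coef_sum; congr (_ * _ * _ * _).
  by apply: eq_bigr => i _; rewrite Defs.coefZ.
apply: (pfS) => T _; apply: (pfS) => Q _; apply: (pfM) => //; apply: (pfM) => //.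
apply: (pfM) => //; apply: (pfS) => i _; apply: (pfM) => //.
exact: mx_poly_fun_entry.
Qed.

Local Notation N := #|{set 'I_n}|.

Definition ext_row f : 'rV[K]_N := \row_j coef f (enum_val j).

Lemma ext_row_coef f S : ext_row f 0 (enum_rank S) = coef f S.
Proof. by rewrite mxE enum_rankK. Qed.

Definition row_ext (v : 'rV[K]_N) : E := [ffun S => v 0 (enum_rank S)].

Lemma row_extK : cancel row_ext ext_row.
Proof. by move=> v; apply/rowP => j; rewrite !mxE /coef ffunE enum_valK. Qed.

Lemma ext_rowK : cancel ext_row row_ext.
Proof. by move=> f; apply: exteriorP => S; rewrite /coef ffunE ext_row_coef. Qed.

(** Its entries are the minors of [A], as in transposed compound matrices. Exterior elements are row
    vectors acted on from the right, so products are reversed in [gl_mxM]. *)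
Definition gl_mx A : 'M[K]_N :=
  \matrix_(i, j) coef (gl_action A (e (enum_val i))) (enum_val j).

Lemma ext_row_gl A f : ext_row (gl_action A f) = ext_row f *m gl_mx A.
Proof.
apply/rowP => j; rewrite !mxE [in LHS](exteriorE f) linear_sum Defs.coef_sum /=.
rewrite (reindex (fun i : 'I_N => enum_val i)) /=; last first.
  exact/onW_bij/enum_val_bij.
by apply: eq_bigr => i _; rewrite linearZ /= Defs.coefZ !mxE.
Qed.

Lemma gl_mxM A B : gl_mx (A *m B) = gl_mx B *m gl_mx A.
Proof.
apply/row_matrixP => i; rewrite row_mul.
have rowE D : row i (gl_mx D) = ext_row (gl_action D (e (enum_val i))).
  by apply/rowP => j; rewrite !mxE.
by rewrite !rowE -gl_action_comp ext_row_gl.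
Qed.

Lemma gl_mx1 : gl_mx 1%:M = 1%:M.
Proof.
apply/matrixP => i j; rewrite !mxE gl_action1 coef_emon.
by rewrite (inj_eq enum_val_inj) eq_sym.
Qed.

Lemma gl_mx_diag (d : 'rV[K]_n) i j :
  gl_mx (diag_mx d) i j = (\prod_(k in enum_val j) d 0 k) * (i == j)%:R.
Proof.
rewrite mxE gl_action_diag Defs.coefZ coef_emon (inj_eq enum_val_inj) eq_sym.
by case: eqVneq => [->|] //; rewrite !mulr0.
Qed.

Lemma gl_mxV A : A \in unitmx -> gl_mx A *m gl_mx (invmx A) = 1%:M.
Proof. by move=> uA; rewrite -gl_mxM mulVmx // gl_mx1. Qed.

End GLAction.

(** * Face numbers of the shifted complex as ranks *)

Section FaceMatrix.
Variables (K : fieldType) (n : nat).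
Local Notation e := (@emon K n).
Local Notation wt := (@rev_weight n).
Implicit Types (S R T : {set 'I_n}) (f g : exterior K n) (A B : 'M[K]_n).
Implicit Types (sigma : {set {set 'I_n}}).

(* The rows indexed by nonfaces span A(J_sigma), the other rows are zero. *)
Definition face_mx sigma A := coord_proj K (~: sigma) *m gl_mx A.

Lemma gl_image_face_mx sigma A g : is_complex sigma ->
  gl_image A (@face_ideal K n sigma) g <-> (ext_row g <= face_mx sigma A)%MS.
Proof.
move=> cs; split=> [[f /(face_idealP _ cs) f0 ->]|/submxP[u uE]].
  rewrite ext_row_gl /face_mx; apply: submxMr; apply/submxP; exists (ext_row f).
  apply/rowP => j; rewrite mul_coord_projE inE; case: ifPn => //.
  by rewrite negbK mxE => /f0.
exists (row_ext (u *m coord_proj K (~: sigma))).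
  apply/(face_idealP _ cs) => S sS.
  by rewrite -ext_row_coef row_extK mul_coord_projE enum_rankK inE sS.
apply: (can_inj (@ext_rowK K n)).
by rewrite ext_row_gl row_extK -mulmxA.
Qed.

Lemma gl_image_mull J A f g : A \in unitmx -> is_ideal J ->
  gl_image A J g -> gl_image A J (f * g).
Proof.
move=> uA [_ _ JM _] [h Jh ->]; exists (gl_action (invmx A) f * h); first exact: JM.
by rewrite gl_actionM gl_action_comp mulmxV // gl_action1.
Qed.

(** A monomial surviving in the product contains [R :\: S], and removing that set lowers its weight
    by a constant, so comparisons of weights are preserved. *)
Lemma is_initial_emonM f S R : is_initial f S -> S \subset R ->
  is_initial (e (R :\: S) * f) R.
Proof.
case=> fS maxS SR.
have RSK : R :\: (R :\: S) = S by rewrite setDDr setDv set0U; apply/setIidPr.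
split=> [|Q].
  rewrite coef_emonM subsetDl RSK mulf_neq0 // /ewedge_sign ifT ?signr_eq0 //.
  by rewrite -setI_eq0 setIC setIDA setDIl setDv set0I.
rewrite coef_emonM; case: ifP => [RSQ|]; last by rewrite eqxx.
rewrite mulf_eq0 negb_or => /andP[_ /maxS]; rewrite !rev_leE => wQ.
have split_wt (X Y : {set 'I_n}) : X \subset Y -> wt Y = (wt X + wt (Y :\: X))%N.
  move=> XY; rewrite -rev_weightU; last by rewrite -setI_eq0 setDE setICA setICr setI0.
  by rewrite -{1}(setID Y X) (setIidPr XY).
by rewrite (split_wt _ _ RSQ) (split_wt _ _ (subsetDl R S)) RSK leq_add2l.
Qed.

Lemma is_initial_row f S : is_initial f S <->
  ext_row f 0 (enum_rank S) != 0 /\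
  forall Q, ext_row f 0 (enum_rank Q) != 0 -> (wt Q <= wt S)%N.
Proof.
rewrite ext_row_coef; split=> -[fS H]; split=> // Q.
  by rewrite ext_row_coef => /H; rewrite rev_leE.
by rewrite rev_leE -ext_row_coef; apply: H.
Qed.

Lemma init_set_face_mx sigma A S : is_complex sigma ->
  reflect (exists2 f, gl_image A (@face_ideal K n sigma) f & is_initial f S)
          (S \in init_set wt (face_mx sigma A)).
Proof.
move=> cs; rewrite inE; apply: (iffP (asboolP _)).
  case=> v [vW vS vQ]; exists (row_ext v).
    by apply/(gl_image_face_mx _ _ cs); rewrite row_extK.
  by apply/is_initial_row; rewrite row_extK.
case=> f /(gl_image_face_mx _ _ cs) fW /is_initial_row[fS fQ].
by exists (ext_row f).
Qed.

(** The initial monomials of an ideal are closed under supersets, so the ideal they generate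
    contains no further monomial. Invertibility of [A] makes the image of the face ideal stable
    under multiplication. *)
Lemma shift_byE sigma A : is_complex sigma -> A \in unitmx ->
  shift_by A sigma = ~: init_set wt (face_mx sigma A).
Proof.
move=> cs uA; set I := init_set _ _; apply/setP => S; rewrite in_setC inE.
apply/asboolP/idP => [nin|SI genS].
  apply: contra_notN nin => /(init_set_face_mx _ _ cs)[f Jf fS] L idL; apply.
  by exists f, S.
have cI : is_complex (~: I).
  move=> R Q; rewrite !in_setC => RI QR; apply: contraNN RI.
  case/(init_set_face_mx _ _ cs) => f Jf fQ.
  apply/(init_set_face_mx _ _ cs); exists (e (R :\: Q) * f).
    by apply: gl_image_mull => //; apply: ideal_gen_ideal.
  exact: is_initial_emonM.
have: face_ideal (~: I) (e S).
  apply: genS; first exact: ideal_gen_ideal.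
  move=> _ [f [R [Jf fR ->]]] L idL; apply; exists R => //.
  by rewrite in_setC negbK; apply/(init_set_face_mx _ _ cs); exists f.
move/(face_idealP _ cI)/(_ S); rewrite in_setC SI => /(_ isT)/eqP.
by rewrite coef_emon eqxx oner_eq0.
Qed.

End FaceMatrix.

Lemma exists_max (X : Type) (P : X -> Prop) (f : X -> nat) (b : nat) x0 :
  P x0 -> (forall x, f x <= b)%N ->
  exists x, P x /\ forall y, P y -> (f y <= f x)%N.
Proof.
move=> Px0 fb; pose Q k := `[< exists2 x, P x & f x = k >].
have exQ : exists k, Q k by exists (f x0); apply/asboolP; exists x0.
have Qb k : Q k -> (k <= b)%N by case/asboolP => x _ <-.
case: (ex_maxnP exQ Qb) => k /asboolP[x Px fx] maxk; exists x; split=> // y Py.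
by rewrite fx; apply: maxk; apply/asboolP; exists y.
Qed.

(** * Counting faces through ranks of projections *)

Section Rank.
Variables (K : fieldType) (n : nat).
Local Notation E := (exterior K n).
Local Notation e := (@emon K n).
Local Notation wt := (@rev_weight n).
Implicit Types (S R T : {set 'I_n}) (f g : E) (A B : 'M[K]_n).
Implicit Types (sigma U : {set {set 'I_n}}).

Definition face_rank sigma A U := \rank (face_mx sigma A *m coord_proj K U).

(** [rev_gt], [rev_ge] and [card_ge] give upward closed sets for the weight, the last because weight
    compares sizes first; so [rank_coord_proj] applies to all three. *)
Definition rev_gt S : {set {set 'I_n}} := [set R | wt S < wt R]%N.
Definition rev_ge S : {set {set 'I_n}} := [set R | wt S <= wt R]%N.
Definition card_ge d : {set {set 'I_n}} := [set R : {set 'I_n} | d <= #|R|]%N.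

Lemma face_rank_rev_gt sigma A S :
  face_rank sigma A (rev_gt S) = #|init_set wt (face_mx sigma A) :&: rev_gt S|.
Proof.
apply: rank_coord_proj; first exact: rev_weight_inj.
by move=> R Q; rewrite !inE; apply: leq_trans.
Qed.

Lemma face_rank_rev_ge sigma A S :
  face_rank sigma A (rev_ge S) = #|init_set wt (face_mx sigma A) :&: rev_ge S|.
Proof.
apply: rank_coord_proj; first exact: rev_weight_inj.
by move=> R Q; rewrite !inE; apply: leq_trans.
Qed.

Lemma face_rank_card_ge sigma A d :
  face_rank sigma A (card_ge d) = #|init_set wt (face_mx sigma A) :&: card_ge d|.
Proof.
apply: rank_coord_proj; first exact: rev_weight_inj.
by move=> R Q; rewrite !inE => dR /rev_weight_card; apply: leq_trans.
Qed.

Lemma rank_coord_projE U : \rank (coord_proj K U) = #|U|.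
Proof.
have := rank_coord_proj (@rev_weight_inj n) (coord_proj K U) (U := setT)
  (fun _ _ _ _ => in_setT _).
rewrite coord_projM !setIT => ->; apply: eq_card => S; rewrite inE.
apply/asboolP/idP => [[v [/submxP[u ->] vS _]]|SU].
  by move: vS; rewrite mul_coord_projE enum_rankK; case: ifP => //; rewrite eqxx.
exists (delta_mx 0 (enum_rank S)); split; last 2 first.
- by rewrite mxE !eqxx oner_neq0.
- move=> Q; rewrite mxE eqxx /= (inj_eq enum_rank_inj).
  by have [->//|_] := eqVneq Q S; rewrite eqxx.
apply/submxP; exists (delta_mx 0 (enum_rank S)); apply/rowP => j.
rewrite mul_coord_projE; case: ifPn => // jU; rewrite mxE eqxx /=.
have [jS|//] := eqVneq j (enum_rank S).
by rewrite jS enum_rankK SU in jU.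
Qed.

(** The action does not raise degree, so the part of an image in sizes at least [d] depends only on
    the part of the source in those sizes. *)
Lemma gl_mx_card_ge A d :
  gl_mx A *m coord_proj K (card_ge d) =
  coord_proj K (card_ge d) *m gl_mx A *m coord_proj K (card_ge d).
Proof.
apply/matrixP => i j; rewrite !mul_coord_projE; case: ifP => //.
rewrite inE mul_diag_mx !mxE inE => dj.
have [_|di] := leqP d #|enum_val i|; first by rewrite mul1r.
rewrite mul0r; apply/eqP; apply: contraTT di => /gl_action_card; rewrite -leqNgt.
exact: leq_trans.
Qed.

(** Both bounds come from [gl_mx_card_ge], applied to [A] and to its inverse. The number of initial
    monomials of size at least [d] is thus independent of [A]. *)
Lemma face_rank_unit_card_ge sigma A d : A \in unitmx ->
  face_rank sigma A (card_ge d) = #|~: sigma :&: card_ge d|.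
Proof.
move=> uA; rewrite -rank_coord_projE -coord_projM /face_rank /face_mx.
set D := coord_proj K (~: sigma); set P := coord_proj K (card_ge d).
apply/eqP; rewrite eqn_leq; apply/andP; split.
  by rewrite -mulmxA gl_mx_card_ge !mulmxA -mulmxA mxrankM_maxl.
have -> : D *m P = D *m gl_mx A *m P *m (gl_mx (invmx A) *m P).
  rewrite -(mulmxA _ P) (mulmxA P) -gl_mx_card_ge mulmxA -(mulmxA D).
  by rewrite gl_mxV // mulmx1.
exact: mxrankM_maxl.
Qed.

(** The sets of size at least [#|S|] are those of size [#|S|] up to [S] together with those above
    [S]. The faces counted are the noninitial sets of the first kind; the identity is additive to
    avoid truncated subtraction. *)
Lemma m_rev_shift_by sigma A S : is_complex sigma -> A \in unitmx ->
  (m_rev S (shift_by A sigma) + #|~: sigma :&: card_ge #|S| | =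
   #|[set R : {set 'I_n} | (#|R| == #|S|) && rev_le R S]| +
   face_rank sigma A (rev_gt S))%N.
Proof.
move=> cs uA; rewrite -(face_rank_unit_card_ge _ _ uA) face_rank_card_ge.
rewrite face_rank_rev_gt /m_rev shift_byE //; set I := init_set _ _.
set D := [set R : {set 'I_n} | (#|R| == #|S|) && rev_le R S].
rewrite (_ : [set R in ~: I | _] = D :\: I); last first.
  by apply/setP => R; rewrite in_setD [LHS]in_set [R \in D]in_set in_setC.
have -> : card_ge #|S| = D :|: rev_gt S.
  apply/setP => R; rewrite /D !inE rev_leE.
  have [wRS|/ltnW/rev_weight_card->] := leqP (wt R) (wt S); last by rewrite andbF.
  by rewrite andbT orbF eqn_leq (rev_weight_card wRS).
rewrite setIUr cardsU -setIIr (_ : D :&: rev_gt S = set0); last first.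
  by apply/setP => R; rewrite !inE rev_leE; case: leqP; rewrite ?andbF.
rewrite setI0 cards0 subn0 addnA; congr (_ + _)%N.
by rewrite -(cardsID I D) setIC addnC.
Qed.

(** Adding the coordinate [S] raises the rank exactly when [S] is initial, so equal ranks for all
    [U] force equal initial sets. *)
Lemma mem_init_set_rank sigma A S :
  ((S \in init_set wt (face_mx sigma A)) + face_rank sigma A (rev_gt S))%N =
  face_rank sigma A (rev_ge S).
Proof.
rewrite face_rank_rev_gt face_rank_rev_ge; set I := init_set _ _.
rewrite [RHS](cardsD1 S) in_setI [S \in rev_ge S]inE leqnn andbT; congr (_ + _)%N.
apply: eq_card => R; rewrite !in_setI in_setD1 in_setI andbCA; congr (_ && _).
rewrite [LHS]inE [R \in rev_ge S]inE ltn_neqAle; congr (_ && _).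
by rewrite (inj_eq (@rev_weight_inj n)) eq_sym.
Qed.

(** An initial ideal is generated by monomials, hence determined by its complex; equality of
    complexes thus transfers to ideals. *)
Lemma initial_idealE (J : E -> Prop) f :
  initial_ideal J f <-> face_ideal (complex_of (initial_ideal J)) f.
Proof.
pose X S := exists2 g, J g & is_initial g S.
have -> : initial_ideal J = ideal_gen (fun g => exists2 S, X S & g = e S).
  congr ideal_gen; apply: funext => g; apply: propext.
  split=> [[h [S [Jh hS ->]]]|[S [h Jh hS] ->]].
    by exists S => //; exists h.
  by exists h, S.
by split=> /face_ideal_complex_of.
Qed.

End Rank.

(** * Generic rank and degeneration to the initial ideal *)

Section Generic.
Variables (K : fieldType) (n : nat).
Hypothesis Kinf : forall s : seq K, exists x : K, x \notin s.
Local Notation e := (@emon K n).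
Local Notation wt := (@rev_weight n).
Implicit Types (S R T : {set 'I_n}) (f g : exterior K n) (A B : 'M[K]_n).
Implicit Types (sigma U : {set {set 'I_n}}).

(** [F] comes from lower semicontinuity at an invertible matrix where the rank, bounded by the
    number of columns, is maximal. *)
Lemma generic_face_rank sigma U : exists F, [/\ mx_poly_fun F,
    exists A, F A != 0 &
    forall A B, F A != 0 -> B \in unitmx ->
      (face_rank sigma B U <= face_rank sigma A U)%N].
Proof.
have rk_le A : (face_rank sigma A U <= #|{set 'I_n}|)%N by apply: rank_leq_col.
have [B [uB maxB]] := exists_max (P := fun A => A \in unitmx) (unitmx1 K n) rk_le.
have [|F [pF FB maxF]] := rank_lower_semicontinuous (@mx_poly_fun_const K n)
    (@mx_poly_funD K n) (@mx_poly_funM K n)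
    (M := fun A => face_mx sigma A *m coord_proj K U) B.
  have Cmx := fun_class_mulmx (@mx_poly_fun_const K n) (@mx_poly_funD K n)
    (@mx_poly_funM K n).
  apply: (Cmx) => [|? ?]; last exact: mx_poly_fun_const.
  apply: (Cmx) => i j; first exact: mx_poly_fun_const.
  rewrite (_ : (fun A => _) =
      fun A => coef (gl_action A (e (enum_val i))) (enum_val j)).
    exact: gl_action_mx_poly_fun.
  by apply: funext => A; rewrite mxE.
exists F; split=> // [|A C FA uC]; first by exists B.
exact: leq_trans (maxB C uC) (maxF A FA).
Qed.

(** There are finitely many [U], so the product [G] of their functions controls all ranks at once.
    Where [G] and [\det] are nonzero the ranks, hence the initial ideals, are constant; this common
    ideal is the generic one. *)
Lemma shift_generic sigma : is_complex sigma ->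
  exists A, [/\ A \in unitmx, shift K sigma = shift_by A sigma &
    forall B U, B \in unitmx -> (face_rank sigma B U <= face_rank sigma A U)%N].
Proof.
move=> cs; have [F FP] := choice (generic_face_rank sigma).
pose G A := \prod_(U : {set {set 'I_n}}) F U A.
have pG : mx_poly_fun G.
  apply: (fun_class_prod (@mx_poly_fun_const K n) (@mx_poly_funM K n)) => U _.
  by case: (FP U).
have G_max A B U : G A != 0 -> B \in unitmx ->
    (face_rank sigma B U <= face_rank sigma A U)%N.
  move=> GA; case: (FP U) => _ _; apply.
  by apply: contraNneq GA => FA; rewrite /G (bigD1 U) //= FA mul0r.
have unit_det A : (A \in unitmx) = (\det A != 0) by rewrite unitmxE unitfE.
have [A0 [GA0 uA0]] : exists A, G A != 0 /\ A \in unitmx.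
  have [||A GA] := mx_poly_fun_meet_seq Kinf (index_enum {set {set 'I_n}}) (F := F).
  - by move=> U; case: (FP U).
  - by move=> U; case: (FP U).
  have [] := mx_poly_fun_meet Kinf pG (mx_poly_fun_det K n) GA (B := 1%:M).
    by rewrite det1 oner_neq0.
  by move=> D [GD dD]; exists D; rewrite unit_det.
pose J := @face_ideal K n sigma.
have inJ A f : G A != 0 -> A \in unitmx ->
    initial_ideal (gl_image A J) f <-> initial_ideal (gl_image A0 J) f.
  move=> GA uA; have rkE U : face_rank sigma A U = face_rank sigma A0 U.
    by apply/eqP; rewrite eqn_leq !G_max.
  have shE : shift_by A sigma = shift_by A0 sigma.
    rewrite !shift_byE //; congr (~: _); apply/setP => S.
    have := mem_init_set_rank sigma A S; rewrite !rkE -mem_init_set_rank.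
    by move/addIn; do 2!case: (_ \in _).
  split=> /initial_idealE H; apply/initial_idealE; move: H.
    by rewrite -/(shift_by A sigma) shE.
  by rewrite -[complex_of (initial_ideal (gl_image A J))]/(shift_by A sigma) shE.
exists A0; split=> // [|B U uB]; last exact: G_max.
suff GinE f : Gin J f <-> initial_ideal (gl_image A0 J) f.
  by apply/setP => S; rewrite !inE; apply/asboolP/asboolP => H /GinE.
split=> [[I [V [[P VP] [A VA] VI]] If]|inf].
  (* The nonempty open set [V] of any other witness [I] meets the locus where [\det] and [G] are
     nonzero; at a common point [B] the initial ideal is both [I] and the one at [A0]. *)
  have [uA [p Pp pA]] := (VP A).1 VA.
  have pp : mx_poly_fun (mx_eval p) by exists p.
  have dG : mx_poly_fun (fun A => \det A * G A).
    exact: mx_poly_funM (mx_poly_fun_det K n) pG.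
  have [] := mx_poly_fun_meet Kinf pp dG pA (B := A0).
    by rewrite mulf_neq0 // -unit_det.
  move=> B [pB]; rewrite mulf_eq0 negb_or -unit_det => /andP[uB GB].
  apply/(inJ B) => //; apply/VI => //; apply/VP; split=> //.
  by exists p.
exists (initial_ideal (gl_image A0 J)) => //.
exists (fun A => A \in unitmx /\ G A != 0); split.
- have [p pE] := pG; exists (eq p) => A; rewrite pE; split=> -[uA pA]; split=> //.
    by exists p.
  by case: pA => _ <-.
- by exists A0.
by move=> A [uA GA] g; apply: inJ.
Qed.

Lemma face_rank_degeneration sigma (phi : 'M[K]_n) A U : is_complex sigma ->
  phi \in unitmx -> A \in unitmx ->
  exists2 B : 'M[K]_n, B \in unitmx &
    (face_rank (shift_by phi sigma) A U <= face_rank sigma B U)%N.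
Proof.
move=> cs uphi uA; set tau := shift_by phi sigma.
(* For a nonface [R] of [tau], [w] is a vector of phi(J_sigma) with initial monomial [R] and leading
   coefficient 1; for a face it is 0. *)
have w_exists R : exists w : 'rV[K]_#|{set 'I_n}|,
    [/\ (w <= face_mx sigma phi)%MS, w 0 (enum_rank R) = (R \notin tau)%:R &
        forall Q, w 0 (enum_rank Q) != 0 -> (wt Q <= wt R)%N].
  rewrite /tau shift_byE // in_setC negbK.
  case: (boolP (R \in _)) => [|_].
    rewrite inE => /asboolP[v [vW vR vQ]].
    exists ((v 0 (enum_rank R))^-1 *: v); split.
    - exact: scalemx_sub.
    - by rewrite mxE mulVf.
    - by move=> Q; rewrite mxE mulf_eq0 negb_or => /andP[_ /vQ].
  by exists 0; split=> [||Q]; rewrite ?sub0mx ?mxE ?eqxx.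
have [w wP] := choice w_exists.
(* [M t] is a row-rescaled basis of D_t phi(J_sigma) for t != 0, and its limit
   [M 0] spans the initial ideal. *)
pose M t : 'M[K]_#|{set 'I_n}| :=
  \matrix_(i, j) (w (enum_val i) 0 j * t ^+ (wt (enum_val i) - wt (enum_val j))).
have M0 : M 0 = coord_proj K (~: tau).
  apply/matrixP => i j; rewrite !mxE in_setC.
  have [<-|ij] := eqVneq i j.
    have [_ wii _] := wP (enum_val i); rewrite subnn mulr1.
    by rewrite -wii enum_valK.
  (* A nonzero off-diagonal coefficient sits in a strictly lighter column, where the exponent is
     positive and the power vanishes at 0. In heavier columns the subtraction truncates, but [w] is
     zero there. *)
  have [->|wij] := eqVneq (w (enum_val i) 0 j) 0; first by rewrite mul0r.
  have [_ _ /(_ (enum_val j))] := wP (enum_val i); rewrite enum_valK => /(_ wij) wji.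
  rewrite expr0n subn_eq0 leqNgt ltn_neqAle wji andbT.
  by rewrite (inj_eq (@rev_weight_inj n)) (inj_eq enum_val_inj) eq_sym ij mulr0.
have [|F [pF F0 Fmax]] := rank_lower_semicontinuous (@poly_fun_const K)
    (@poly_funD K) (@poly_funM K)
    (M := fun t => M t *m (gl_mx A *m coord_proj K U)) 0.
  have Cmx := fun_class_mulmx (@poly_fun_const K) (@poly_funD K) (@poly_funM K).
  apply: (Cmx) => i j; last exact: poly_fun_const.
  exists ((w (enum_val i) 0 j)%:P * 'X^(wt (enum_val i) - wt (enum_val j))) => t.
  by rewrite mxE hornerM hornerC hornerXn.
have pX : poly_fun (fun t : K => t) by exists 'X => t; rewrite hornerX.
(* The second function is the identity, nonzero at 1: it excludes [t = 0], for which [D] would not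
   be usable. *)
have [t [Ft t0]] := poly_fun_meet Kinf pF pX F0 (oner_neq0 K).
(* [D] scales the monomial of [R] by [t ^- wt R]; together with the row factor
   [t ^+ wt (enum_val i)] this yields the exponents in [M t]. *)
pose D := diag_mx (\row_(i < n) t ^- rev_weight1 i).
exists (A *m D *m phi).
  rewrite !unitmx_mul uA uphi andbT /= unitmxE det_diag unitfE prodf_seq_neq0.
  by apply/allP => i _; rewrite mxE invr_eq0 expf_neq0.
have /submxP[Y YE] :
    ((\matrix_(i < #|{set 'I_n}|) w (enum_val i)) <= face_mx sigma phi)%MS.
  by apply/row_subP => i; rewrite rowK; case: (wP (enum_val i)).
have ME : M t =
    diag_mx (\row_(i < #|{set 'I_n}|) t ^+ wt (enum_val i)) *m
    (Y *m face_mx sigma phi) *m gl_mx D.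
  rewrite -YE mul_diag_mx; apply/matrixP => i j; rewrite mxE.
  rewrite mxE (bigD1 j) //= big1 ?addr0 => [|k kj]; last first.
    by rewrite gl_mx_diag (negPf kj) !mulr0.
  rewrite gl_mx_diag eqxx mulr1 !mxE.
  rewrite (_ : \prod_(k in enum_val j) _ = t ^- wt (enum_val j)); last first.
    by rewrite /rev_weight -prodrXr -prodfV; apply: eq_bigr => k _; rewrite mxE.
  have [->|wij] := eqVneq (w (enum_val i) 0 j) 0; first by rewrite mulr0 !mul0r.
  have [_ _ /(_ (enum_val j))] := wP (enum_val i); rewrite enum_valK => /(_ wij) wji.
  by rewrite mulrAC mulrC expfB_cond ?(negPf t0).
have := Fmax t Ft; rewrite M0 mulmxA => /leq_trans -> //.
(* [M t] is a left multiple of [face_mx sigma phi *m gl_mx D], and left factors cannot increase the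
   rank. *)
rewrite ME /face_rank /face_mx !gl_mxM !mulmxA -!mulmxA.
by rewrite (mulmxA _ Y) mxrankM_maxr.
Qed.

End Generic.

Theorem theorem3p1 (K : fieldType) (n : nat)
    (Kinf : forall s : seq K, exists x : K, x \notin s)
    (sigma : {set {set 'I_n}}) (sigmaP : is_complex sigma)
    (phi : 'M[K]_n) (phiP : phi \in unitmx) (S : {set 'I_n}) :
  (m_rev S (shift K sigma) >= m_rev S (shift K (shift_by phi sigma)))%N.
Proof.
set tau := shift_by phi sigma.
have tauP : is_complex tau by apply: is_complex_shift_by.
have [A [uA -> A_max]] := shift_generic Kinf sigmaP.
have [B [uB -> _]] := shift_generic Kinf tauP.
have [C uC BC] := face_rank_degeneration Kinf (rev_gt S) sigmaP phiP uB.
(* Passing to [tau] preserves the number of nonfaces of size at least [#|S|], so the constants in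
   the two instances of [m_rev_shift_by] cancel and only the ranks above [S] remain to be
   compared. *)
have card_tau : #|~: tau :&: card_ge n #|S| | = #|~: sigma :&: card_ge n #|S| |.
  rewrite -(face_rank_unit_card_ge sigma _ phiP) face_rank_card_ge.
  by rewrite /tau shift_byE // setCK.
have mA := m_rev_shift_by S sigmaP uA.
have := m_rev_shift_by S tauP uB; rewrite card_tau => mB.
rewrite -(leq_add2r #|~: sigma :&: card_ge n #|S| |) mA mB leq_add2l.
exact: leq_trans BC (A_max C _ uC).
Qed.
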